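(* Let $g$ be a (nonnegative) radial, decreasing function in $\mathbb{R}^n$. Then for $2\leq p<\infty$, \[ \|M_{\nu_n}g\|_{L^{p,\infty}(\nu_n)}^\ast\leq \frac p{p-1}\, 2^{2/p}\, \|g\|_{L^{p,1}(\nu_n)}^\ast . \]
   Context: $B(x,R)$ denotes the Euclidean ball in $\mathbb{R}^n$ centred at $x$ with radius $R$. $\nu_n$ is Lebesgue measure restricted to the Euclidean unit ball of $\mathbb{R}^n$ centred at the origin. The maximal function associated to a Radon measure $\mu$ is \[ M_\mu g(x)=\sup_{R>0,\ \mu(B(x,R))>0}\frac1{\mu(B(x,R))}\int_{B(x,R)}|g(y)|\,d\mu(y). \] A radial, decreasing function is one of the form $g(x)=g_0(|x|)$ with $g_0:[0,\infty)\to[0,\infty]$ non-increasing and finite on $(0,\infty)$. For a measurable $f$, $f^\ast$ denotes its non-increasing rearrangement with respect to $\mu$. The Lorentz quasinorms are, for $1\le p<\infty$ and $1\le q<\infty$, \[ \|f\|_{L^{p,q}(\mu)}^\ast = \left(\frac qp\int_0^\infty [s^{1/p}f^\ast(s)]^q\,\frac{ds}s\right)^{1/q}, \] and $\|f\|_{L^{p,\infty}(\mu)}^\ast=\sup_{s>0}s^{1/p}f^\ast(s)=\sup_{\lambda>0}\lambda\,\mu(\{|f|>\lambda\})^{1/p}$. *)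

(* Defs.v *)
From HB Require Import structures.
From mathcomp Require Import all_boot all_order all_algebra.
From mathcomp Require Import all_classical all_reals all_analysis.
From mathcomp Require Import measurable_realfun.

Set Implicit Arguments.
Unset Strict Implicit.
Unset Printing Implicit Defensive.

Import Order.TTheory GRing.Theory Num.Theory.
Import numFieldNormedType.Exports.

Local Open Scope classical_set_scope.
Local Open Scope ring_scope.

Notation Rn R n := (n.-tuple (measurableTypeR R)).

Section n_dimensional_lebesgue_measure.
Context {R : realType}.

Definition consRn n (xt : measurableTypeR R * Rn R n) : Rn R n.+1 :=
  [the n.+1.-tuple (measurableTypeR R) of xt.1 :: xt.2].

Definition unconsRn n (t : Rn R n.+1) : measurableTypeR R * Rn R n :=
  (tnth t ord0, [tuple of behead t]).

Lemma consRnK n : cancel (@consRn n) (@unconsRn n).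
Proof.
by case=> x t; rewrite /unconsRn/=; congr (_, _); apply/val_inj.
Qed.

Lemma measurable_consRn n : measurable_fun [set: _] (@consRn n).
Proof. by apply: measurable_cons. Qed.

Lemma measurable_unconsRn n : measurable_fun [set: _] (@unconsRn n).
Proof.
apply/measurable_fun_pairP; split=> /=; first exact: measurable_tnth.
exact: measurable_behead.
Qed.

Local Open Scope ereal_scope.

Definition lebesgue_cons n (m : {sigma_finite_measure set (Rn R n) -> \bar R}) :
    set (Rn R n.+1) -> \bar R :=
  pushforward (lebesgue_measure \x m) (@consRn n).

Section lebesgue_cons_measure.
Context n (m : {sigma_finite_measure set (Rn R n) -> \bar R}).

Let measurable_pre A : measurable A -> measurable (@consRn n @^-1` A).
Proof. by move=> mA; rewrite -[X in measurable X]setTI; exact: measurable_consRn. Qed.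

Let lebesgue_cons0 : lebesgue_cons m set0 = 0.
Proof. by rewrite /lebesgue_cons /pushforward preimage_set0 measure0. Qed.

Let lebesgue_cons_ge0 A : 0 <= lebesgue_cons m A.
Proof. exact: (measure_ge0 (lebesgue_measure \x m)). Qed.

Let lebesgue_cons_sigma_additive : semi_sigma_additive (lebesgue_cons m).
Proof.
move=> F mF tF mUF; rewrite /lebesgue_cons /pushforward preimage_bigcup.
apply: measure_semi_sigma_additive.
- by move=> k; exact: measurable_pre.
- apply/trivIsetP => /= i j _ _ ij; rewrite -preimage_setI.
  by move/trivIsetP : tF => /(_ _ _ _ _ ij) ->//; rewrite preimage_set0.
- by rewrite -preimage_bigcup; exact: measurable_pre.
Qed.

HB.instance Definition _ := isMeasure.Build _ _ _ (lebesgue_cons m)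
  lebesgue_cons0 lebesgue_cons_ge0 lebesgue_cons_sigma_additive.

Let lebesgue_cons_sigma_finite : sigma_finite [set: _] (lebesgue_cons m).
Proof.
have /sigma_finiteP[F [TF ndF mF]] := sigma_finiteT (@lebesgue_measure R).
have /sigma_finiteP[G [TG ndG mG]] := sigma_finiteT m.
exists (fun k => @unconsRn n @^-1` (F k `*` G k)).
  rewrite -preimage_bigcup (_ : \bigcup_k _ = setT) ?preimage_setT//.
  apply/seteqP; split=> // -[x y] _.
  have : [set: measurableTypeR R] x by [].
  have : [set: Rn R n] y by [].
  rewrite TF TG => -[j _ Gjy] [i _ Fix].
  exists (maxn i j) => //; split.
  - by move: x Fix; exact/subsetPset/ndF/leq_maxl.
  - by move: y Gjy; exact/subsetPset/ndG/leq_maxr.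
move=> k; have [mFk Fk] := mF k; have [mGk Gk] := mG k; split.
  rewrite -[X in measurable X]setTI; apply: measurable_unconsRn => //.
  exact: measurableX.
rewrite /lebesgue_cons /pushforward -comp_preimage.
rewrite (_ : _ \o _ = id); last by apply/funext => x /=; rewrite consRnK.
by rewrite preimage_id product_measure1E// lte_mul_pinfty// ge0_fin_numE.
Qed.

HB.instance Definition _ := Measure_isSigmaFinite.Build _ _ _ (lebesgue_cons m)
  lebesgue_cons_sigma_finite.

End lebesgue_cons_measure.

(* lebesgue_Rn_box below characterizes this measure on the Borel sets. *)
Fixpoint lebesgue_Rn n : {sigma_finite_measure set (Rn R n) -> \bar R} :=
  if n is k.+1 then lebesgue_cons (lebesgue_Rn k) else \d_ [tuple].

Lemma lebesgue_Rn_box n (A : 'I_n -> set (measurableTypeR R)) :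
  (forall i, measurable (A i)) ->
  lebesgue_Rn n [set x | forall i, tnth x i \in A i] =
  \prod_(i < n) lebesgue_measure (A i).
Proof.
elim: n A => [|n IH] A mA /=.
  by rewrite big_ord0 diracE mem_set// => -[].
rewrite big_ord_recl /lebesgue_cons /pushforward -IH//=.
rewrite -product_measure1E//; last first.
  rewrite (_ : [set _ | _] =
     \bigcap_(i in [set: 'I_n]) ((fun x : Rn R n => tnth x i) @^-1` A (lift ord0 i))).
    apply: fin_bigcap_measurable; first exact: finite_finset.
    by move=> i _; rewrite -[X in measurable X]setTI; exact: measurable_tnth.
  by apply/seteqP; split => x /= xA i => [_|]; [exact/set_mem/xA|exact/mem_set/xA].
congr (_ _); apply/seteqP; split => -[x t] /=.
  move=> xA; split; first by have := xA ord0; rewrite inE.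
  by move=> i; have := xA (lift ord0 i); rewrite tnthS.
move=> [xA tA] i; case: (unliftP ord0 i) => [j ->|->]; first by rewrite tnthS.
exact/mem_set.
Qed.

End n_dimensional_lebesgue_measure.

Section euclidean_balls.
Context {R : realType} {n : nat}.
Implicit Types x y : Rn R n.

Definition edist x y : R :=
  Num.sqrt (\sum_(i < n) ((tnth x i : R) - (tnth y i : R)) ^+ 2).

Definition originRn : Rn R n := [tuple of nseq n (0 : R)].

Definition enorm x : R := edist x originRn.

Definition eball x (r : R) : set (Rn R n) := [set y | edist x y < r].

Lemma measurable_eball x r : measurable (eball x r).
Proof.
rewrite [X in measurable X](_ : _ =
   [set: _] `&` (fun y => edist x y : R) @^-1` `]-oo, r[%classic).
  suff H : measurable_fun [set: Rn R n] (fun y => edist x y : R).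
    by apply: H => //; exact: measurable_itv.
  apply: (@measurableT_comp _ _ _ _ _ _ (@Num.sqrt R)).
    by apply: continuous_measurable_fun; exact: sqrt_continuous.
  apply: measurable_sum => i; apply: measurable_funX.
  apply: measurable_funB => //.
  exact: (@measurable_tnth _ (measurableTypeR R) n i).
by apply/seteqP; split=> y; rewrite /eball/= in_itv/=; [split|case].
Qed.

End euclidean_balls.

Definition nu (R : realType) (n : nat) : set (Rn R n) -> \bar R :=
  mrestr (lebesgue_Rn n) (measurable_eball originRn 1).
Arguments nu R n : clear implicits.

HB.instance Definition _ (R : realType) (n : nat) := Measure.on (nu R n).

Local Open Scope ereal_scope.

Definition maximal {R : realType} (n : nat)
    (mu : {measure set (Rn R n) -> \bar R}) (g : Rn R n -> \bar R)
    (x : Rn R n) : \bar R :=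
  ereal_sup [set (mu (eball x r))^-1 * \int[mu]_(y in eball x r) `|g y| |
             r in [set r : R | (0 < r)%R /\ 0 < mu (eball x r)]].

Definition radial_decreasing {R : realType} (n : nat) (g : Rn R n -> \bar R) :=
  exists g0 : R -> \bar R,
    [/\ forall r : R, (0 <= r)%R -> 0 <= g0 r,
        forall r s : R, (0 <= r)%R -> (r <= s)%R -> g0 s <= g0 r,
        forall r : R, (0 < r)%R -> g0 r \is a fin_num &
        forall x, g x = g0 (enorm x)].

Section lorentz_quasinorms.
Context d (T : measurableType d) (R : realType).
Variable mu : {measure set T -> \bar R}.
Implicit Types (f : T -> \bar R) (p q : R).

(* The infimum is +oo when no level qualifies. *)
Definition rearrangement f (s : R) : \bar R :=
  ereal_inf [set l%:E | l in
    [set l : R | (0 <= l)%R /\ mu [set x | l%:E < `|f x|] <= s%:E]].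

Definition lorentz_norm p q f : \bar R :=
  poweR ((q / p)%:E *
    \int[@lebesgue_measure R]_(s in `]0%R, +oo[)
      (poweR ((s `^ p^-1)%:E * rearrangement f s) q * (s^-1)%:E)) q^-1.

Definition weak_lorentz_norm p f : \bar R :=
  ereal_sup [set (s `^ p^-1)%:E * rearrangement f s | s in `]0%R, +oo[].

End lorentz_quasinorms.

(* Main.v *)
Require Import Defs.
From HB Require Import structures.
From mathcomp Require Import all_boot all_order all_algebra.
From mathcomp Require Import all_classical all_reals all_analysis.
From mathcomp Require Import measurable_realfun ring lra.

(* For [|x| < 1], [t <= |x|] and [a = sqrt (|x| / t)], the affine map
   [y |-> a y + (1 - 1 / a) x] sends [B(0, t)] intersected with [B(x, R)] into
   [B(0, |x|)] intersected with [B(x, R)]. Comparing volumes, a level set [E] of [g]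
   satisfies [nu (E `&` B(x, R)) <= (nu E / nu B(0, |x|))^(1/2) * nu B(x, R)] when the
   ratio is at most 1, and the exponent [1/2] may then be lowered to [1/p]. Integrating
   over the levels of [g] gives [M g x <= nu B(0, |x|)^(-1/p) * ||g||_(p,1)], and the
   right-hand side has weak [L^p] quasinorm at most [||g||_(p,1)]. The inequality thus
   holds with the constant 1, which is at most [p / (p - 1) * 2^(2/p)]. *)

Import Order.TTheory GRing.Theory Num.Theory.
Import numFieldNormedType.Exports.

Local Open Scope classical_set_scope.
Local Open Scope ring_scope.

(* [edist] alone would denote the extended distance of the topology library. *)
Local Notation edist := Defs.edist.

(** * Tonelli's theorem for sections and the layer-cake formula *)

Lemma sections_tonelli d1 d2 (T1 : measurableType d1) (T2 : measurableType d2)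
    (R : realType) (m1 : {sigma_finite_measure set T1 -> \bar R})
    (m2 : {sigma_finite_measure set T2 -> \bar R}) (A : set (T1 * T2)) :
  measurable A ->
  (\int[m1]_x m2 (xsection A x) = \int[m2]_y m1 (ysection A y))%E.
Proof.
move=> mA.
have := @indic_fubini_tonelli _ _ T1 T2 R m1 m2 A mA.
by rewrite indic_fubini_tonelli_FE// indic_fubini_tonelli_GE.
Qed.

(** Both sides measure the region [A] under the graph of [f] over [D], sliced vertically on the left
    and horizontally on the right. The vertical slice at [x] is the interval from 0 to [f x], a
    half-line when [f x] is infinite. *)
Lemma ge0_layer_cake d (T : measurableType d) (R : realType)
    (mu : {sigma_finite_measure set T -> \bar R}) (D : set T) (f : T -> \bar R) :
  measurable D -> measurable_fun [set: T] f -> (forall x, 0 <= f x)%E ->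
  (\int[mu]_(x in D) f x =
   \int[lebesgue_measure]_(t in `[0%R, +oo[) mu (D `&` [set x | t%:E < f x]))%E.
Proof.
move=> mD mf f0.
pose A : set (T * measurableTypeR R) :=
  [set z | [/\ D z.1, 0 <= z.2 & (z.2%:E < f z.1)%E]].
have mA : measurable A.
  rewrite [A](_ : _ = (D `*` `[(0 : R), +oo[%classic) `&`
    ([set: _] `&` [set z : T * measurableTypeR R | (z.2%:E < f z.1)%E])); last first.
    apply/seteqP; split=> -[x t]/=; rewrite in_itv/= andbT.
      by case.
    by case=> -[? ?] [_ ?]; split.
  apply: measurableI; first by apply: measurableX => //; exact: measurable_itv.
  apply: measurable_lte => //.
    by apply/measurable_EFinP; exact: measurable_snd.
  by apply: measurableT_comp => //; exact: measurable_fst.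
have AE := @sections_tonelli _ _ T (measurableTypeR R) R mu lebesgue_measure A mA.
rewrite [in LHS]integral_mkcond [in RHS]integral_mkcond.
transitivity (\int[mu]_x lebesgue_measure (xsection A x))%E.
  apply: eq_integral => x _; rewrite patchE; case: ifPn => Dx; last first.
    rewrite (_ : xsection A x = set0) ?measure0//.
    by rewrite -subset0 => t; rewrite xsectionP => -[/= /mem_set]; rewrite (negbTE Dx).
  move: Dx; rewrite inE => Dx.
  rewrite (_ : xsection A x = [set t | (0 <= t) && (t%:E < f x)%E]); last first.
    apply/seteqP; split => t; rewrite xsectionP /A/=; first by case=> _ -> ->.
    by move=> /andP[].
  have := f0 x; case: (f x) => [r|_|//].
  - rewrite lee_fin => r0.
    rewrite (_ : [set t | _] = `[0, r[%classic); last first.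
      by apply/seteqP; split => t /=; rewrite in_itv/= lte_fin.
    rewrite lebesgue_measure_itv/= lte_fin oppr0 adde0.
    by case: ltgtP r0 => // <-.
  - rewrite (_ : [set t | _] = `[(0 : R), +oo[%classic); last first.
      by apply/seteqP; split => t /=; rewrite in_itv/= ltry andbT.
    by rewrite lebesgue_measure_itv/= ltry oppr0 adde0.
rewrite AE; apply: eq_integral => t _; rewrite patchE.
case: ifPn; rewrite ?inE ?notin_setE/= in_itv/= andbT => t0.
  congr (mu _); apply/seteqP; split => x; rewrite ysectionP /A/=; first by case.
  by case.
rewrite (_ : ysection A t = set0) ?measure0//.
by rewrite -subset0 => x; rewrite ysectionP /A/= => -[].
Qed.

(** * The Lorentz norm with second exponent 1 and the distribution function *)

Lemma integral_powR_itv (R : realType) (a x y : R) : 0 < x -> x < y ->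
  (\int[lebesgue_measure]_(s in `[x, y]) (a * s `^ (a - 1))%:E =
   (y `^ a)%:E - (x `^ a)%:E)%E.
Proof.
move=> x0 xy.
have pos s : s \in `[x, y] -> s \in `]0, +oo[.
  by rewrite !in_itv/= andbT => /andP[xs _]; exact: lt_le_trans xs.
have cts (b s : R) : s \in `[x, y] -> (fun u : R => u `^ b) u @[u --> s] --> s `^ b.
  move=> /pos s0.
  apply: (@differentiable_continuous _ R^o R^o s (fun x : R => x `^ b)).
  by apply/derivable1_diffP; exact: derivable_powR.
rewrite (@continuous_FTC2 R (fun s => a * s `^ (a - 1)) (fun s => s `^ a)) //=.
- apply: continuous_in_subspaceT => s; rewrite inE => sxy.
  by apply: cvgM; [exact: cvg_cst|exact: cts].
- split.
  + move=> s /subset_itv_oo_cc /pos; exact: derivable_powR.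
  + apply: cvg_at_right_filter; apply: cts.
    by rewrite in_itv/= lexx ltW.
  + apply: cvg_at_left_filter; apply: cts.
    by rewrite in_itv/= lexx ltW.
- by move=> s /subset_itv_oo_cc /pos s0; rewrite powR_derive1.
Qed.

(** This is the half of [m^a = int_0^m a s^(a-1) ds] used below. Integrating only over compact
    intervals inside []0, m[] avoids the singularity at 0 and covers [m = +oo] as well. *)
Lemma poweR_le_integral (R : realType) (a : R) (m : \bar R) : 0 < a ->
  (0 <= m ->
   poweR m a <= \int[lebesgue_measure]_(s in `]0%R, +oo[ `&` [set s | s%:E < m])
      (a * s `^ (a - 1))%:E)%E.
Proof.
move=> a0 m0; set D := _ `&` _; set I := (X in (_ <= X)%E).
have mD : measurable D.
  apply: is_interval_measurable => s t/= [s0 sm] [t0 tm] u /andP[su ut].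
  split; first by move: s0; rewrite /= !in_itv/= !andbT => s0; exact: lt_le_trans su.
  by apply: le_lt_trans tm; rewrite lee_fin.
have mk E : measurable_fun E (fun s : R => (a * s `^ (a - 1))%:E).
  apply/measurable_EFinP; apply: measurable_funTS; apply: measurable_funM => //.
have k0 s : (0 <= (a * s `^ (a - 1))%:E)%E by rewrite lee_fin mulr_ge0 ?powR_ge0// ltW.
have I0 : (0 <= I)%E by exact: integral_ge0.
(* For [e < z] the integral over [[e^(1/a), z^(1/a)]] is exactly [z - e], and this interval lies in
   [D]; then [e] tends to 0. *)
have aI z : 0 < z -> (z%:E < poweR m a)%E -> (z%:E <= I)%E.
  move=> z0 zm; apply/lee_subgt0Pr => e e0.
  have [ze|ez] := leP z e.
    by apply: le_trans I0; rewrite leNgt -EFinB lte_fin -leNgt subr_le0.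
  have K x : 0 < x -> (x `^ a^-1) `^ a = x.
    by move=> x0; rewrite -powRrM mulVf ?gt_eqF// powRr1// ltW.
  have zmb : ((z `^ a^-1)%:E < m)%E.
    rewrite ltNge; apply/negP => mz; move: zm; rewrite ltNge => /negP; apply.
    case: m m0 mz {D I mD I0} => [m| |//]; last by rewrite leye_eq.
    move=> m0 mz; rewrite poweR_EFin lee_fin -[leRHS](K z)//.
    rewrite !lee_fin in m0 mz.
    by rewrite ge0_ler_powR// ?nnegrE// ?powR_ge0// ltW.
  rewrite -EFinB -{1}(K z)// -(K e)// EFinB -integral_powR_itv//; last 2 first.
  - exact: powR_gt0.
  - by rewrite gt0_ltr_powR// ?invr_gt0// nnegrE ltW.
  apply: ge0_subset_integral => //; first exact: mk.
  move=> s; rewrite /= in_itv => /andP[s1 s2]; split => /=.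
    by rewrite in_itv/= andbT (lt_le_trans _ s1)// powR_gt0.
  by apply: le_lt_trans zmb; rewrite lee_fin.
rewrite leNgt; apply/negP => Im.
have If : I \is a fin_num by rewrite ge0_fin_numE//; exact: lt_le_trans Im (leey _).
move: Im; rewrite -(fineK If) => Im.
have [z /andP[Iz zm]] : exists z : R, (fine I < z) && (z%:E < poweR m a)%E.
  case: (poweR m a) Im => [y| |//]; last first.
    by move=> _; exists (fine I + 1); rewrite ltrDl ltr01 ltry.
  rewrite lte_fin => /midf_lt[Iz zy]; exists ((fine I + y) / 2).
  by rewrite lte_fin Iz zy.
have := aI z (le_lt_trans (fine_ge0 I0) Iz) zm.
by rewrite -(fineK If) lee_fin leNgt Iz.
Qed.

(** Superlevel sets of a non-increasing function are intervals, hence Borel. *)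
Lemma nonincreasing_emeasurable (R : realType) (f : R -> \bar R) :
  (forall s t : R, s <= t -> (f t <= f s)%E) ->
  measurable_fun [set: measurableTypeR R] f.
Proof.
move=> ndf; apply: (measurability _ (ErealGenOInfty.measurableE R)).
move=> /= _ [_ [y ->] <-]; rewrite setTI; apply: is_interval_measurable.
move=> s t /=; rewrite !in_itv/= !andbT => ys yt u /andP[su ut].
by rewrite in_itv/= andbT (lt_le_trans yt)// ndf.
Qed.

Section lorentz_distribution_function.
Context d (T : measurableType d) (R : realType).
Variables (mu : {measure set T -> \bar R}) (f : T -> \bar R).
Hypothesis mf : measurable_fun [set: T] f.

Let m t := mu [set x | (t%:E < `|f x|)%E].

Let m_nonincreasing (s t : R) : s <= t -> (m t <= m s)%E.
Proof.
have mlevel u : measurable [set x | (u%:E < `|f x|)%E].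
  rewrite -[X in measurable X]setTI; apply: emeasurable_fun_o_infty => //.
  exact: measurableT_comp.
move=> st; apply: le_measure; rewrite ?inE// => x /=.
by apply: le_lt_trans; rewrite lee_fin.
Qed.

Let m_measurable : measurable_fun [set: measurableTypeR R] m.
Proof. exact: nonincreasing_emeasurable. Qed.

Lemma rearrangement_ge0 s : (0 <= rearrangement mu f s)%E.
Proof. by apply: le_ereal_inf_tmp => _ [l [l0 _] <-]; rewrite lee_fin. Qed.

Lemma rearrangement_measurable :
  measurable_fun [set: measurableTypeR R] (rearrangement mu f).
Proof.
apply: nonincreasing_emeasurable => s t st; apply: ereal_inf_le_tmp.
by move=> _ [l [l0 ml] <-]; exists l => //; split=> //; apply: le_trans ml _; rewrite lee_fin.
Qed.

(** Since [m] is non-increasing, a [t] with [m t > s] cannot exceed a level [l] with [m l <= s]. The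
    set is therefore contained in the interval from 0 to the infimum of such levels. *)
Lemma lebesgue_le_rearrangement (s : R) :
  (lebesgue_measure [set t : R | (0 <= t)%R /\ (s%:E < m t)%E] <= rearrangement mu f s)%E.
Proof.
have ub t : (s%:E < m t)%E -> (t%:E <= rearrangement mu f s)%E.
  move=> smt; apply: le_ereal_inf_tmp => _ [l [l0 ml] <-].
  rewrite lee_fin leNgt; apply/negP => lt.
  by have := lt_le_trans smt (le_trans (m_nonincreasing _ _ (ltW lt)) ml); rewrite ltxx.
have mA : measurable [set t : R | 0 <= t /\ (s%:E < m t)%E].
  apply: is_interval_measurable => x y /= [x0 _] [_ my] z /andP[xz zy]; split.
    exact: le_trans xz.
  exact: lt_le_trans my (m_nonincreasing _ _ zy).
case: (rearrangement mu f s) ub (rearrangement_ge0 s) => [r ub| _ _|//]; last by rewrite leey.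
rewrite lee_fin => r0.
apply: (@le_trans _ _ (lebesgue_measure `[0, r]%classic)).
  apply: le_measure; rewrite ?inE//.
  by move=> t [t0 /ub]; rewrite lee_fin/= in_itv/= t0.
rewrite lebesgue_measure_itv/= lte_fin oppr0 adde0.
by case: ltgtP r0 => // <-.
Qed.

(** With [a = 1/p], bound [(m t)^a] by the integral of [a s^(a-1)] over [0 < s < m t] and exchange
    the order of integration. For fixed [s] the remaining measure in [t] is at most the
    rearrangement at [s]. *)
Lemma lorentz_norm1_ge p : 1 < p ->
  (\int[lebesgue_measure]_(t in `[0%R, +oo[) poweR (m t) p^-1 <=
   lorentz_norm mu p 1 f)%E.
Proof.
move=> p1; have p0 : 0 < p by exact: lt_trans p1.
set a := p^-1; have a0 : 0 < a by rewrite invr_gt0.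
pose k (s : R) := a * s `^ (a - 1).
have k0 s : 0 <= k s by rewrite mulr_ge0 ?powR_ge0// ltW.
have mk : measurable_fun [set: measurableTypeR R] k.
  by apply: measurable_funM => //; exact: (@measurable_powR R (a - 1)).
(* For [q = 1] the outer power disappears, and the factors [1/p], [s^(1/p)] and [1/s] combine into
   the kernel [k s]. *)
have -> : lorentz_norm mu p 1 f =
    (\int[lebesgue_measure]_(s in `]0%R, +oo[) ((k s)%:E * rearrangement mu f s))%E.
  rewrite /lorentz_norm invr1 poweRe1; last first.
    rewrite mule_ge0 ?lee_fin ?divr_ge0 ?(ltW p0)//.
    apply: integral_ge0 => s; rewrite /= in_itv/= andbT => s0.
    by rewrite mule_ge0 ?poweR_ge0// lee_fin invr_ge0 ltW.
  rewrite (eq_integral (fun s : measurableTypeR R =>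
    (s `^ (a - 1))%:E * rearrangement mu f s)%E); last first.
    move=> s; rewrite inE/= in_itv/= andbT => s0.
    rewrite poweRe1; last by rewrite mule_ge0 ?rearrangement_ge0// lee_fin powR_ge0.
    rewrite muleAC -EFinM powRB ?powRr1 ?(ltW s0)//.
    by rewrite (gt_eqF s0) implybT.
  rewrite -ge0_integralZl//=; last 3 first.
  - apply: emeasurable_funM; last by apply: measurable_funTS; exact: rearrangement_measurable.
    by apply/measurable_EFinP/measurable_funTS; exact: (@measurable_powR R (a - 1)).
  - by move=> s _; rewrite mule_ge0 ?rearrangement_ge0// lee_fin powR_ge0.
  - by rewrite lee_fin divr_ge0// ltW.
  by apply: eq_integral => s _; rewrite muleA div1r.
pose A : set (measurableTypeR R * measurableTypeR R) :=
  [set z | [/\ 0 <= z.1, 0 < z.2 & (z.2%:E < m z.1)%E]].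
have mA : measurable A.
  rewrite [A](_ : _ = (`[0%R, +oo[%classic `*` `]0%R, +oo[%classic) `&`
    ([set: _] `&` [set z : measurableTypeR R * measurableTypeR R |
      (z.2%:E < m z.1)%E])); last first.
    apply/seteqP; split=> -[x t]/=; rewrite !in_itv/= !andbT.
      by case.
    by case=> -[? ?] [_ ?]; split.
  apply: measurableI; first by apply: measurableX => //; exact: measurable_itv.
  apply: measurable_lte => //.
    by apply/measurable_EFinP; exact: measurable_snd.
  by apply: measurableT_comp => //; exact: measurable_fst.
pose F (z : measurableTypeR R * measurableTypeR R) : \bar R := (k z.2 * \1_A z)%:E.
have mF : measurable_fun [set: _] F.
  apply/measurable_EFinP; apply: measurable_funM; last exact: measurable_indic.
  by apply: measurableT_comp => //; exact: measurable_snd.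
have F0 z : (0 <= F z)%E by rewrite lee_fin mulr_ge0.
have FE := @fubini_tonelli _ _ _ _ R lebesgue_measure lebesgue_measure F mF F0.
apply: (@le_trans _ _ (\int[lebesgue_measure]_t \int[lebesgue_measure]_s F (t, s))%E).
  rewrite [leLHS]integral_mkcond; apply: ge0_le_integral.
  - exact: measurableT.
  - by move=> t _; apply: erestrict_ge0 => u _; rewrite poweR_ge0.
  - apply: (iffLR (measurable_restrictT _ (measurable_itv _))).
    apply: measurable_funTS; exact: (measurableT_comp (measurable_poweR _)).
  - exact: measurable_fun_fubini_tonelli_F.
  move=> t _; rewrite patchE; case: ifPn; last by move=> _; exact: integral_ge0.
  rewrite inE/= in_itv/= andbT => t0.
  apply: le_trans (poweR_le_integral _ _ _ a0 (measure_ge0 _ _)) _.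
  rewrite le_eqVlt; apply/orP; left; apply/eqP; rewrite integral_mkcond.
  apply: eq_integral => s _; rewrite patchE /F/= indicE.
  case: ifPn => [|/negP sA].
    rewrite inE/= in_itv/= andbT => -[s0 sm].
    have ts : A (t, s) by split.
    by rewrite (mem_set ts) mulr1.
  have ts : ~ A (t, s).
    move=> -[_ s0 sm]; apply: sA; apply/mem_set.
    have s0' : s \in `]0, +oo[ by rewrite in_itv/= andbT.
    exact: (conj s0' sm).
  by rewrite (memNset ts) mulr0.
(* After the exchange, the inner integral is [k s] times the Lebesgue measure of the section of [A]
   at height [s]. *)
rewrite FE [leRHS]integral_mkcond; apply: ge0_le_integral.
- exact: measurableT.
- by move=> s _; exact: integral_ge0.
- exact: measurable_fun_fubini_tonelli_G.
- apply: (iffLR (measurable_restrictT _ (measurable_itv _))); apply: emeasurable_funM.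
    exact/measurable_EFinP/measurable_funTS.
  by apply: measurable_funTS; exact: rearrangement_measurable.
move=> s _; rewrite patchE; case: ifPn => [|/negP sD]; last first.
  rewrite le_eqVlt; apply/orP; left; apply/eqP; apply: integral0_eq => t _; rewrite /F/= indicE.
  have ts : ~ A (t, s).
    move=> -[_ s0 _]; apply: sD; apply/mem_set.
    have s0' : s \in `]0, +oo[ by rewrite in_itv/= andbT.
    exact: s0'.
  by rewrite (memNset ts) mulr0.
rewrite inE/= in_itv/= andbT => s0.
have mB : measurable (ysection A s) by exact: measurable_ysection.
rewrite (eq_integral (fun t : measurableTypeR R =>
  (k s)%:E * (\1_(ysection A s) t)%:E)%E); last first.
  by move=> t _; rewrite /F/= EFinM !indicE mem_ysection.
rewrite ge0_integralZl; last 4 first.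
- exact: measurableT.
- exact/measurable_EFinP/measurable_indic.
- by move=> t _; rewrite lee_fin.
- by rewrite lee_fin.
rewrite integral_indic; [rewrite setIT | exact: measurableT | exact: mB].
apply: lee_wpmul2l; first by rewrite lee_fin.
rewrite (_ : ysection A s = [set t : R | (0 <= t)%R /\ (s%:E < m t)%E]).
  exact: lebesgue_le_rearrangement.
apply/seteqP; split => t; rewrite ysectionP => -[t0]; last exact: And3.
by move=> _ st; exact: conj t0 st.
Qed.

End lorentz_distribution_function.

(** * Lebesgue measure under dilations and translations *)

Lemma lebesgue_measure_affine (R : realType) (a b : R) (A : set (measurableTypeR R)) :
  0 < a -> measurable A ->
  lebesgue_measure ((fun x : measurableTypeR R => a * x + b : measurableTypeR R) @^-1` A) =
  ((a^-1)%:E * lebesgue_measure A)%E.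
Proof.
move=> a0 mA.
pose f : measurableTypeR R -> measurableTypeR R := fun x => a * x + b; rewrite -/f.
have mf : measurable_fun [set: measurableTypeR R] f.
  by apply: measurable_funD => //; exact: measurable_funM.
(* [mu] is [a] times the push-forward of Lebesgue measure along [f]. It gives half-open intervals
   their length, so it is Lebesgue measure by uniqueness. *)
pose mu : {measure set (measurableTypeR R) -> \bar R} :=
  mscale (NngNum (ltW a0))
    (measure_function_pushforward__canonical__measure_function_Measure lebesgue_measure mf).
have muE : forall X, measurable X -> lebesgue_measure X = mu X.
  apply: lebesgue_measure_unique => _ [[x y] _ <-].
  rewrite /mu/= /mscale/= /pushforward.
  rewrite (_ : f @^-1` _ = `](x - b) / a, (y - b) / a]%classic); last first.
    apply/seteqP; split => t; rewrite /f/= !in_itv/= ltr_pdivrMr// ler_pdivlMr//;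
      by rewrite ltrBlDr lerBrDr [t * a]mulrC.
  rewrite !lebesgue_measure_itv/= !lte_fin ltr_pM2r ?invr_gt0// ltrD2r.
  case: ifPn => _; last by rewrite mule0.
  by rewrite -!EFinB -EFinM -mulrBl mulrC divfK ?gt_eqF// opprB addrA subrK.
by rewrite (muE A mA) /mu/= /mscale/= /pushforward muleA -EFinM mulVf ?gt_eqF// mul1e.
Qed.

Definition affineRn (R : realType) (n : nat) (a : R) (b y : Rn R n) : Rn R n :=
  [tuple a * tnth y i + tnth b i | i < n].

Lemma measurable_affineRn (R : realType) (n : nat) (a : R) (b : Rn R n) :
  measurable_fun [set: Rn R n] (affineRn R n a b).
Proof.
apply/measurable_fun_tnthP => i.
rewrite (_ : _ \o _ = fun y : Rn R n => a * tnth y i + tnth b i); last first.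
  by apply/funext => y; rewrite /= tnth_mktuple.
apply: measurable_funD => //; apply: measurable_funM => //.
exact: measurable_tnth.
Qed.

(** Induction on the dimension: the map acts separately on the first coordinate and on the tail. So
    [a^(n+1)] times the push-forward of the product measure has the right value on rectangles, and
    uniqueness of the product measure extends this to all measurable sets. *)
Lemma lebesgue_Rn_affine (R : realType) (n : nat) (a : R) (b : Rn R n) (A : set (Rn R n)) :
  0 < a -> measurable A ->
  lebesgue_Rn n (affineRn R n a b @^-1` A) = ((a ^- n)%:E * lebesgue_Rn n A)%E.
Proof.
move=> a0; elim: n b A => [|n IH] b A mA.
  rewrite expr0 invr1 mul1e (_ : _ @^-1` _ = A)//.
  by apply/seteqP; split => x /=; rewrite [affineRn _ _ _ _ _]tuple0 [x]tuple0.
pose f : measurableTypeR R -> measurableTypeR R := fun x => a * x + tnth b ord0.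
pose b' : Rn R n := [tuple of behead b].
pose F : measurableTypeR R * Rn R n -> measurableTypeR R * Rn R n :=
  fun z => (f z.1, affineRn R n a b' z.2).
have mf : measurable_fun [set: measurableTypeR R] f.
  by apply: measurable_funD => //; exact: measurable_funM.
have mF : measurable_fun [set: _] F.
  apply/measurable_fun_pairP; split.
    by apply: (measurableT_comp mf); exact: measurable_fst.
  by apply: (measurableT_comp (measurable_affineRn _ _ _ _)); exact: measurable_snd.
have an0 : 0 < a ^+ n.+1 by rewrite exprn_gt0.
pose mu : {measure set (measurableTypeR R * Rn R n) -> \bar R} :=
  mscale (NngNum (ltW an0)) (measure_function_pushforward__canonical__measure_function_Measure
    (lebesgue_measure \x lebesgue_Rn n)%E mF).
have muE : forall X, measurable X -> (lebesgue_measure \x lebesgue_Rn n)%E X = mu X.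
  apply: product_measure_unique => X Y mX mY.
  rewrite /mu/= /mscale/= /pushforward.
  rewrite (_ : F @^-1` _ = (f @^-1` X) `*` (affineRn R n a b' @^-1` Y))//.
  rewrite product_measure1E; last 2 first.
  - by rewrite -[Z in measurable Z]setTI; exact: mf.
  - by rewrite -[Z in measurable Z]setTI; exact: measurable_affineRn.
  transitivity ((a ^+ n.+1)%:E *
      (((a^-1)%:E * lebesgue_measure X) * ((a ^- n)%:E * lebesgue_Rn n Y)))%E.
    congr (_ * (_ * _))%E; first exact: lebesgue_measure_affine.
    exact: IH.
  rewrite [X in (_ * X)%E]muleACA !muleA -!EFinM -mulrA -invfM -exprS.
  by rewrite mulfV ?gt_eqF// mul1e.
rewrite /= /lebesgue_cons /pushforward.
have mA' : measurable (@consRn R n @^-1` A).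
  by rewrite -[Z in measurable Z]setTI; exact: measurable_consRn.
rewrite (muE _ mA') /mu/= /mscale/= /pushforward muleA -EFinM mulVf ?gt_eqF// mul1e.

(* Prepending the first coordinate intertwines the split map [F] with the affine map in dimension
   [n + 1]. *)
have consF : affineRn R n.+1 a b \o @consRn R n = @consRn R n \o F.
  apply/funext => -[x t]; apply: eq_from_tnth => i; rewrite /= tnth_mktuple.
  case: (unliftP ord0 i) => [j ->|->//].
  rewrite !tnthS tnth_mktuple; congr (_ + _).
  by rewrite [b in LHS]tuple_eta tnthS.
have -> : @consRn R n @^-1` (affineRn R n.+1 a b @^-1` A) =
          (affineRn R n.+1 a b \o @consRn R n) @^-1` A by [].
by rewrite consF.
Qed.

(** * Euclidean norm and the affine map of the lens *)

Section euclidean_geometry.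
Context (R : realType) (n : nat).
Implicit Types (x y : Rn R n).

Lemma edist_ge0 x y : 0 <= edist x y.
Proof. exact: sqrtr_ge0. Qed.

Lemma edist_sqr x y : edist x y ^+ 2 = \sum_(i < n) ((tnth x i : R) - (tnth y i : R)) ^+ 2.
Proof. by rewrite sqr_sqrtr// sumr_ge0// => i _; exact: sqr_ge0. Qed.

Lemma tnth_originRn (i : 'I_n) : tnth (@originRn R n) i = 0 :> R.
Proof. by rewrite (tnth_nth 0) nth_nseq if_same. Qed.

Lemma enorm_sqr x : enorm x ^+ 2 = \sum_(i < n) (tnth x i : R) ^+ 2.
Proof.
rewrite /enorm edist_sqr; apply: eq_bigr => i _; rewrite tnth_originRn. by rewrite subr0.
Qed.

Lemma measurable_enorm : measurable_fun [set: Rn R n] (@enorm R n : _ -> measurableTypeR R).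
Proof.
apply: (@measurableT_comp _ _ _ _ _ _ (@Num.sqrt R)).
  by apply: continuous_measurable_fun; exact: sqrt_continuous.
apply: measurable_sum => i; apply: measurable_funX; apply: measurable_funB => //.
exact: (@measurable_tnth _ (measurableTypeR R) n i).
Qed.

Lemma coord_le_enorm x i : `|tnth x i : R| <= enorm x.
Proof.
rewrite -(ler_pXn2r (n := 2)) ?nnegrE ?edist_ge0// enorm_sqr (bigD1 i)//=.
by rewrite real_normK ?num_real// lerDl sumr_ge0// => j _; exact: sqr_ge0.
Qed.

Lemma edist_originC x : edist (originRn : Rn R n) x = enorm x.
Proof.
by rewrite /enorm /Defs.edist; congr (Num.sqrt _); apply: eq_bigr => i _; rewrite -sqrrN opprB.
Qed.

Lemma eball_originE (r : R) : eball (originRn : Rn R n) r = [set y | enorm y < r].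
Proof. by apply/seteqP; split => y; rewrite /eball/= edist_originC. Qed.

Let dot x y : R := \sum_(i < n) (tnth x i : R) * (tnth y i : R).

Let sum_sqr_lin (a b : R) x y :
  \sum_(i < n) (a * tnth x i + b * tnth y i) ^+ 2 =
  a ^+ 2 * enorm x ^+ 2 + (a * b * dot x y) *+ 2 + b ^+ 2 * enorm y ^+ 2.
Proof.
rewrite !enorm_sqr /dot !mulr_sumr -sumrMnl -!big_split/=.
by apply: eq_bigr => i _; ring.
Qed.

(* [a = sqrt (|x| / t)] is the largest dilation factor for which [enorm z <= enorm x], as
   [y = (t / |x|) x] shows. *)
Lemma ball_lens_affine (a t : R) x y :
  0 < a -> 0 < t -> a ^+ 2 * t = enorm x -> 1 <= a -> enorm y <= t ->
  let z := affineRn R n a [tuple (1 - a^-1) * tnth x i | i < n] y in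
  enorm z <= enorm x /\ edist x z <= edist x y.
Proof.
move=> a0 t0 at2 a1 yt z; set b := 1 - a^-1.
have y0 : 0 <= enorm y by exact: edist_ge0.
have x0 : 0 < enorm x by rewrite -at2 mulr_gt0// exprn_gt0.
have ab : a * b = a - 1 by rewrite mulrBr mulr1 mulfV ?gt_eqF.
have b0 : 0 <= b by rewrite subr_ge0 invf_le1.
have zE i : tnth z i = a * tnth y i + b * tnth x i :> R by rewrite !tnth_mktuple.
have Yt : enorm y ^+ 2 <= t ^+ 2 by rewrite ler_pXn2r// nnegrE ltW.
(* A form of Cauchy-Schwarz, obtained by expanding the square of the norm of [|x| y - t x] and using
   [|y| <= t]. *)
have dxy : dot y x <= t * enorm x.
  have : 0 <= \sum_(i < n) (enorm x * tnth y i + - t * tnth x i) ^+ 2.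
    by apply: sumr_ge0 => i _; exact: sqr_ge0.
  rewrite sum_sqr_lin; rewrite mulrN mulNr sqrrN => H.
  rewrite -(ler_pM2l (mulr_gt0 t0 x0)).
  have : enorm x ^+ 2 * enorm y ^+ 2 <= enorm x ^+ 2 * t ^+ 2.
    by rewrite ler_wpM2l ?sqr_ge0// Yt.
  by move: H; lra.
split.
  rewrite -(ler_pXn2r (n := 2))// ?nnegrE ?(ltW x0)// ?edist_ge0//.
  rewrite [leLHS]enorm_sqr (eq_bigr (fun i => (a * tnth y i + b * tnth x i) ^+ 2)); last first.
    by move=> i _; rewrite zE.
  rewrite sum_sqr_lin ab.
  have bX : b ^+ 2 * enorm x ^+ 2 = (a - 1) ^+ 2 * t * enorm x.
    by rewrite -ab -at2; ring.
  have aY : a ^+ 2 * enorm y ^+ 2 <= a ^+ 2 * t ^+ 2 by rewrite ler_wpM2l ?sqr_ge0.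
  have aD : (a - 1) * dot y x <= (a - 1) * (t * enorm x) by rewrite ler_wpM2l ?subr_ge0.
  (* Replacing [|y|] by [t] and [y . x] by [t |x|] bounds [|z|^2] by [(a t + b |x|)^2], which is
     [|x|^2] because [|x| / a = a t]. The comparison is made term by term. *)
  rewrite bX [leRHS](_ : _ = a ^+ 2 * t ^+ 2 + (a - 1) * (t * enorm x) *+ 2 +
      (a - 1) ^+ 2 * t * enorm x); last by rewrite -at2; ring.
  by rewrite lerD// lerD// lerMn2r aD orbT.
rewrite -(ler_pXn2r (n := 2))// ?nnegrE ?edist_ge0//.
rewrite !edist_sqr (eq_bigr (fun i => (- a * tnth y i + a^-1 * tnth x i) ^+ 2)); last first.
  move=> i _; rewrite zE /b. congr (_ ^+ 2); ring.
rewrite [leRHS](eq_bigr (fun i => (- 1 * tnth y i + 1 * tnth x i) ^+ 2)); last first.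
  move=> i _; congr (_ ^+ 2); ring.
(* Since [x - z = x / a - a y], the cross terms of [|x - z|^2] and [|x - y|^2] coincide. Their
   difference involves only squared norms and is displayed below as a sum of nonnegative terms. *)
rewrite !sum_sqr_lin.
have aX : a^-1 ^+ 2 * enorm x ^+ 2 = t * (a ^+ 2 * t).
  by rewrite -at2; field; rewrite gt_eqF.
rewrite aX mulNr mulfV ?gt_eqF// -at2 -subr_ge0.
rewrite [leRHS](_ : _ = (a ^+ 2 - 1) * (t ^+ 2 - enorm y ^+ 2) +
  ((a ^+ 2 - 1) * t) ^+ 2); last by ring.
by rewrite addr_ge0 ?sqr_ge0// mulr_ge0 ?subr_ge0 ?exprn_ege1.
Qed.

End euclidean_geometry.

(** * Monotonicity of volume, volumes of balls and lenses *)

Section ball_volume.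
Context (R : realType).

(** The integral of a nonnegative function is a supremum over the simple functions below it, and a
    larger function only enlarges that family. *)
Lemma ge0_le_integral_nonmeasurable d (T : measurableType d)
    (mu : {measure set T -> \bar R}) (D : set T) (f g : T -> \bar R) :
  (forall x, D x -> 0 <= f x)%E -> (forall x, D x -> f x <= g x)%E ->
  (\int[mu]_(x in D) f x <= \int[mu]_(x in D) g x)%E.
Proof.
move=> f0 fg; rewrite [leLHS]integral_mkcond [leRHS]integral_mkcond.
have fg' x : ((f \_ D) x <= (g \_ D) x)%E.
  by rewrite !patchE; case: ifPn => // /set_mem/fg.
have f0' x : (0 <= (f \_ D) x)%E by exact: erestrict_ge0.
have g0' x : (0 <= (g \_ D) x)%E by exact: le_trans (fg' x).
rewrite !ge0_integralTE//; apply: ereal_sup_le => _ [h hf <-].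
by exists h => // x; exact: le_trans (fg' x).
Qed.

(* Monotonicity without measurability: the superlevel sets of the maximal function
   need not be shown measurable. *)
Lemma lebesgue_Rn_le (n : nat) (A B : set (Rn R n)) :
  A `<=` B -> (lebesgue_Rn n A <= lebesgue_Rn n B)%E.
Proof.
elim: n A B => [|n IH] A B AB.
  rewrite /= !diracE lee_fin ler_nat.
  by case: (boolP (_ \in A)) => // /set_mem/AB/mem_set ->.
rewrite /= /lebesgue_cons /pushforward.
(* On every set, measurable or not, the product measure is by definition the integral of the
   measures of the sections. *)
apply: ge0_le_integral_nonmeasurable => x _; first exact: measure_ge0.
by apply: IH => t; rewrite /= !xsectionP => /AB.
Qed.

Lemma lebesgue_Rn_unit_ball_fin (n : nat) :
  (lebesgue_Rn n (eball originRn (1 : R)) < +oo)%E.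
Proof.
apply: (@le_lt_trans _ _ (lebesgue_Rn n [set x | forall i, tnth x i \in `[(- 1 : R), 1]%classic])).
  apply: lebesgue_Rn_le => x; rewrite eball_originE /= => x1 i.
  rewrite inE/= in_itv/= -ler_norml.
  exact: le_trans (coord_le_enorm _ _ x i) (ltW x1).
rewrite lebesgue_Rn_box => [|i]; last exact: measurable_itv.
rewrite (eq_bigr (fun=> (1 - -1 : R)%:E)); first by rewrite prodEFin ltry.
by move=> i _; rewrite lebesgue_measure_itv/= lte_fin gtrN.
Qed.

Lemma lebesgue_Rn_unit_ball_gt0 (n : nat) :
  (0 < lebesgue_Rn n (eball originRn (1 : R)))%E.
Proof.
(* Points of the cube [[0, e]^n] have squared norm at most [n / (n+1)^2 < 1]. Taking [n + 1] rather
   than [n] keeps [e] positive for [n = 0] and the inequality strict for [n = 1]. *)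
pose e : R := n.+1%:R^-1.
have e0 : 0 < e by rewrite invr_gt0.
apply: (@lt_le_trans _ _ (lebesgue_Rn n [set x | forall i, tnth x i \in `[0%R, e]%classic])).
  rewrite lebesgue_Rn_box => [|i]; last exact: measurable_itv.
  rewrite (eq_bigr (fun=> e%:E)); first by rewrite prodEFin lte_fin prodr_gt0.
  by move=> i _; rewrite lebesgue_measure_itv/= lte_fin e0 oppr0 adde0.
apply: lebesgue_Rn_le => x; rewrite eball_originE /= => xe.
rewrite -(ltr_pXn2r (n := 2)) ?nnegrE ?edist_ge0// enorm_sqr expr1n.
apply: (@le_lt_trans _ _ (\sum_(i < n) e ^+ 2)).
  apply: ler_sum => i _; have := xe i; rewrite inE/= in_itv/= => /andP[xi0 xie].
  by rewrite ler_pXn2r// nnegrE ltW.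
rewrite sumr_const card_ord -mulr_natl /e exprVn ltr_pdivrMr ?exprn_gt0// mul1r.
rewrite -natrX ltr_nat.
by rewrite expnS expn1 mulnS; apply: (leq_trans (ltnSn n)); rewrite leq_addr.
Qed.

Definition unit_ball_volume (n : nat) : R := fine (lebesgue_Rn n (eball originRn (1 : R))).

Lemma unit_ball_volumeE (n : nat) :
  lebesgue_Rn n (eball originRn (1 : R)) = (unit_ball_volume n)%:E.
Proof.
rewrite fineK// ge0_fin_numE; first exact: lebesgue_Rn_unit_ball_fin.
exact: measure_ge0.
Qed.

Lemma unit_ball_volume_gt0 (n : nat) : 0 < unit_ball_volume n.
Proof. by have := lebesgue_Rn_unit_ball_gt0 n; rewrite unit_ball_volumeE lte_fin. Qed.

Lemma enorm_scale (n : nat) (a : R) (y : Rn R n) : 0 <= a ->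
  enorm (affineRn R n a originRn y) = a * enorm y.
Proof.
move=> a0; apply: (pexpIrn (n := 2)) => //; rewrite ?nnegrE ?mulr_ge0// ?edist_ge0//.
rewrite exprMn !enorm_sqr mulr_sumr; apply: eq_bigr => i _.
by rewrite tnth_mktuple tnth_originRn addr0 exprMn.
Qed.

Lemma lebesgue_Rn_eball (n : nat) (r : R) : 0 < r ->
  lebesgue_Rn n (eball originRn r) = (r ^+ n * unit_ball_volume n)%:E.
Proof.
move=> r0; rewrite EFinM -unit_ball_volumeE.
have := @lebesgue_Rn_affine R n r^-1 originRn (eball originRn 1).
rewrite invr_gt0 exprVn invrK => <-//; last exact: measurable_eball.
congr (lebesgue_Rn n _); rewrite !eball_originE; apply/seteqP; split => y /=.
  by rewrite enorm_scale ?invr_ge0 ?(ltW r0)// ltr_pdivrMl// mulr1.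
by rewrite enorm_scale ?invr_ge0 ?(ltW r0)// ltr_pdivrMl// mulr1.
Qed.

(** Supplies the centred ball with the volume of a given level set; the [n]-th root requires
    positive dimension. *)
Lemma ball_radius_of_volume (n : nat) (e : R) : (0 < n)%N -> 0 <= e ->
  exists2 t : R, 0 <= t & t ^+ n * unit_ball_volume n = e.
Proof.
move=> n_gt0 e0; have V0 := unit_ball_volume_gt0 n.
exists ((e / unit_ball_volume n) `^ n%:R^-1); first exact: powR_ge0.
have eV : 0 <= e / unit_ball_volume n by rewrite divr_ge0// ltW.
rewrite -powR_mulrn ?powR_ge0// -powRrM mulVf ?pnatr_eq0 -?lt0n//.
by rewrite powRr1// divfK ?gt_eqF.
Qed.

(** The affine map of [ball_lens_affine] sends [A] into [B(x, r)] intersected with the unit ball, as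
    [|x| < 1], and multiplies volumes by [a^n], where [1 / a = sqrt (t / |x|)]. *)
Lemma lebesgue_Rn_lens (n : nat) (t r : R) (x : Rn R n) (A : set (Rn R n)) :
  measurable A -> 0 < t -> t <= enorm x -> enorm x < 1 ->
  (forall y, A y -> enorm y <= t /\ edist x y < r) ->
  (lebesgue_Rn n A <= (Num.sqrt (t / enorm x) ^+ n)%:E * nu R n (eball x r))%E.
Proof.
move=> mA t0 tx x1 Axr; have x0 : 0 < enorm x by exact: lt_le_trans tx.
set a := Num.sqrt (enorm x / t).
have xt1 : 1 <= enorm x / t by rewrite ler_pdivlMr// mul1r.
have a0 : 0 < a by rewrite sqrtr_gt0 divr_gt0.
have a1 : 1 <= a by rewrite -sqrtr1 ler_wsqrtr.
have at2 : a ^+ 2 * t = enorm x by rewrite sqr_sqrtr ?divfK ?gt_eqF// divr_ge0 ?ltW.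
have -> : Num.sqrt (t / enorm x) = a^-1.
  by rewrite /a -sqrtrV ?divr_ge0 ?ltW// invf_div.
rewrite exprVn /nu /mrestr -(@lebesgue_Rn_affine R n a [tuple (1 - a^-1) * tnth x i | i < n]) => //.
  apply: lebesgue_Rn_le => y /Axr[yt xyr].
  have /=[zx xz] := ball_lens_affine R n a t x y a0 t0 at2 a1 yt.
  split; first exact: le_lt_trans xz xyr.
  by rewrite eball_originE/=; exact: le_lt_trans zx x1.
by apply: measurableI; exact: measurable_eball.
Qed.

End ball_volume.

Lemma nu_fin_num (R : realType) (n : nat) : fin_num_fun (nu R n).
Proof.
move=> A mA; rewrite ge0_fin_numE ?measure_ge0//.
apply: le_lt_trans (lebesgue_Rn_unit_ball_fin R n).
by apply: lebesgue_Rn_le => x [].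
Qed.

(** Finiteness provides the sigma-finite structure under which the layer-cake formula applies to
    [nu]. *)
HB.instance Definition _ (R : realType) (n : nat) :=
  @Measure_isFinite.Build _ _ _ (nu R n) (nu_fin_num R n).

(** * Pointwise bound for the maximal function of a radial decreasing function *)

Section radial_decreasing_maximal.
Context (R : realType) (n : nat) (n_gt0 : (0 < n)%N).

Let V := unit_ball_volume R n.

Let V_gt0 : 0 < V. Proof. exact: unit_ball_volume_gt0. Qed.

(** Let [t] be the radius of the centred ball with the volume of [E]; then [E] lies in the closed
    ball of radius [t]. If [|x| <= t], monotonicity suffices; otherwise the lens bound gives the
    square root of the volume ratio as density. *)
Lemma down_closed_density (p r : R) (E : set (Rn R n)) (x : Rn R n) :
  2 <= p -> measurable E -> E `<=` eball originRn 1 ->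
  (forall y z, E y -> enorm z <= enorm y -> E z) ->
  0 < enorm x -> enorm x < 1 ->
  (((enorm x ^+ n * V) `^ p^-1)%:E * lebesgue_Rn n (eball x r `&` E) <=
   poweR (lebesgue_Rn n E) p^-1 * nu R n (eball x r))%E.
Proof.
move=> p2 mE E1 Edown x0 x1; have p0 : 0 < p by exact: lt_le_trans p2.
have p'0 : 0 <= p^-1 by rewrite invr_ge0 ltW.
have mB : measurable (eball x r) by exact: measurable_eball.
have Efin : lebesgue_Rn n E \is a fin_num.
  rewrite ge0_fin_numE ?measure_ge0//.
  by apply: le_lt_trans (lebesgue_Rn_unit_ball_fin R n); exact: lebesgue_Rn_le.
have [t t0 tE] := ball_radius_of_volume R n _ n_gt0 (fine_ge0 (measure_ge0 (lebesgue_Rn n) E)).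
have EE : lebesgue_Rn n E = (t ^+ n * V)%:E by rewrite tE fineK.
(* As [E] is down-closed, it contains the open centred ball of radius [|y|], whose volume would
   exceed that of [E] if [|y| > t]. *)
have Et y : E y -> enorm y <= t.
  move=> Ey; rewrite leNgt; apply/negP => ty.
  have y0 : 0 < enorm y by exact: le_lt_trans ty.
  have : (lebesgue_Rn n (eball originRn (enorm y)) <= lebesgue_Rn n E)%E.
    apply: lebesgue_Rn_le => z; rewrite eball_originE => /ltW.
    exact: Edown.
  rewrite lebesgue_Rn_eball// EE lee_fin ler_pM2r//.
  by rewrite leNgt ltr_pXn2r ?ty ?nnegrE// ltW.
have xV0 : 0 <= enorm x ^+ n * V by rewrite mulr_ge0 ?exprn_ge0 ?ltW.
have tV0 : 0 <= t ^+ n * V by rewrite mulr_ge0 ?exprn_ge0 ?(ltW V_gt0).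
rewrite EE poweR_EFin.
have [xt|tx] := leP (enorm x) t.
  apply: lee_pmul => //.
  - by rewrite lee_fin powR_ge0.
  - rewrite lee_fin ge0_ler_powR// ler_pM2r// ler_pXn2r// nnegrE ltW//.
  - by apply: lebesgue_Rn_le => y [By /E1].
(* The dilation factor [sqrt (|x| / t)] requires [t > 0]; for [t = 0] the set [E] is null. *)
have [t_eq0|t_gt0] : t = 0 \/ 0 < t by move: t0; rewrite le_eqVlt => /predU1P[|]; auto.
  have -> : lebesgue_Rn n (eball x r `&` E) = 0%E.
    apply/eqP; rewrite eq_le measure_ge0 andbT.
    apply: (@le_trans _ _ (lebesgue_Rn n E)); first by apply: lebesgue_Rn_le => y [].
    by rewrite EE t_eq0 expr0n gtn_eqF// mul0r.
  by rewrite mule0 mule_ge0 ?lee_fin ?powR_ge0.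
have u0 : 0 < t / enorm x by rewrite divr_gt0.
have u1 : t / enorm x <= 1 by rewrite ler_pdivrMr// mul1r ltW.
(* Here [p >= 2] enters: the ratio is at most 1, so lowering the exponent from [1/2] to [1/p]
   increases the power. *)
have sqrtu : Num.sqrt (t / enorm x) ^+ n <= ((t / enorm x) ^+ n) `^ p^-1.
  rewrite -powR12_sqrt ?(ltW u0)// -[leLHS]powR_mulrn ?powR_ge0//.
  rewrite -[leLHS]powRrM [2^-1 * _]mulrC powRrM.
  rewrite powR_mulrn ?(ltW u0)// ger_powR//.
    by rewrite exprn_gt0//= exprn_ile1// ltW.
  by rewrite lef_pV2 ?posrE.
have := @lebesgue_Rn_lens R n t r x (eball x r `&` E).
move=> /(_ (measurableI _ _ mB mE) t_gt0 (ltW tx) x1) lens.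
apply: (@le_trans _ _ (((enorm x ^+ n * V) `^ p^-1)%:E *
    ((Num.sqrt (t / enorm x) ^+ n)%:E * nu R n (eball x r)))%E).
  apply: lee_wpmul2l; first by rewrite lee_fin powR_ge0.
  by apply: lens => y [By /Et].
rewrite muleA -EFinM; apply: lee_wpmul2r => //.
rewrite lee_fin; apply: (@le_trans _ _ ((enorm x ^+ n * V) `^ p^-1 * ((t / enorm x) ^+ n) `^ p^-1)).
  by rewrite ler_wpM2l ?powR_ge0.
rewrite -powRM ?exprn_ge0 ?(ltW u0)// mulrAC -exprMn.
by rewrite [enorm x * _]mulrC divfK ?gt_eqF.
Qed.

Context (g : Rn R n -> \bar R) (g_rd : radial_decreasing g).

Let g_ge0 y : (0 <= g y)%E.
Proof. by case: g_rd => g0 [g00 _ _ ->]; rewrite g00// edist_ge0. Qed.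

Let g_down y z : enorm z <= enorm y -> (g y <= g z)%E.
Proof. by case: g_rd => g0 [_ ndg0 _ gE] zy; rewrite !gE ndg0// edist_ge0. Qed.

Let g_measurable : measurable_fun [set: Rn R n] g.
Proof.
case: g_rd => g0 [_ ndg0 _ gE].
(* The profile [g0] is monotone only on [[0, +oo[]; composing it with [Num.max r 0] makes it
   monotone on the whole line. *)
have -> : g = (fun r : measurableTypeR R => g0 (Num.max r 0)) \o
    (@enorm R n : _ -> measurableTypeR R).
  by apply/funext => y; rewrite gE /= max_l// edist_ge0.
apply: measurableT_comp; last exact: measurable_enorm.
apply: nonincreasing_emeasurable => s t st; apply: ndg0.
  by rewrite le_max lexx orbT.
by rewrite ge_max !le_max lexx st orbT.
Qed.

Let level_set_measurable (t : R) : measurable [set y | (t%:E < `|g y|)%E].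
Proof.
rewrite -[X in measurable X]setTI; apply: emeasurable_fun_o_infty => //.
exact: measurableT_comp.
Qed.

(** On each ball the layer-cake formula turns the average of [g] into an integral over levels.
    [down_closed_density] bounds each level set, and [lorentz_norm1_ge] bounds the resulting
    integral by the norm. *)
Lemma maximal_le_lorentz_norm (p : R) (x : Rn R n) :
  2 <= p -> 0 < enorm x -> enorm x < 1 ->
  (maximal (nu R n) g x <=
   lorentz_norm (nu R n) p 1 g * (((enorm x ^+ n * V) `^ p^-1)^-1)%:E)%E.
Proof.
move=> p2 x0 x1.
set c := (_ `^ _); have c0 : 0 < c by rewrite powR_gt0// mulr_gt0// exprn_gt0.
apply: ge_ereal_sup => _ [r [r0 B0] <-].
rewrite lee_pdivlMr//.
have mB : measurable (eball x r) by exact: measurable_eball.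
have Bfin := nu_fin_num R n _ mB.
have B0' : 0 < fine (nu R n (eball x r)) by rewrite fine_gt0// B0 -ge0_fin_numE ?measure_ge0.
pose k : R := c / fine (nu R n (eball x r)).
have -> : (((nu R n : {measure set (Rn R n) -> \bar R}) (eball x r))^-1)%E =
    ((fine (nu R n (eball x r)))^-1)%:E.
  transitivity (((fine (nu R n (eball x r)))%:E)^-1)%E; last by rewrite inver gt_eqF.
  by congr (_^-1)%E; apply/esym; exact: fineK.
rewrite muleAC -EFinM [_^-1 * _]mulrC -/k.
apply: le_trans (lorentz_norm1_ge _ _ _ (nu R n) g g_measurable p _); last first.
  by apply: lt_le_trans p2; rewrite ltr1n.
rewrite (@ge0_layer_cake _ _ R (nu R n) (eball x r) (fun y => `|g y|)%E) //; last first.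
  exact: measurableT_comp.
rewrite -ge0_integralZl; last 4 first.
- exact: measurable_itv.
- apply: measurable_funTS; apply: nonincreasing_emeasurable => s t st.
  apply: lebesgue_Rn_le => y [[By ty] y1]; split=> //; split => //.
  by apply: le_lt_trans ty; rewrite lee_fin.
- by move=> t _; exact: measure_ge0.
- by rewrite lee_fin divr_ge0// ltW.
apply: ge0_le_integral_nonmeasurable => t _.
  by rewrite mule_ge0// lee_fin divr_ge0// ltW.
(* The [nu]-measure of a level set is the Lebesgue measure of its part in the unit ball, which is
   still down-closed. *)
have mE := measurableI _ _ (level_set_measurable t) (measurable_eball (originRn : Rn R n) 1).
have Edown y z : ([set y | (t%:E < `|g y|)%E] `&` eball originRn 1) y ->
    enorm z <= enorm y -> ([set y | (t%:E < `|g y|)%E] `&` eball originRn 1) z.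
  rewrite eball_originE /= => -[ty y1] zy; split; last exact: le_lt_trans zy y1.
  by rewrite gee0_abs//; apply: lt_le_trans (g_down _ _ zy); rewrite -(gee0_abs (g_ge0 y)).
have := down_closed_density p r _ x p2 mE (@subIsetr _ _ _) Edown x0 x1.
rewrite setIA -/c => H.
have -> : k%:E = (c%:E * (fine (nu R n (eball x r)))^-1%:E)%E by rewrite -EFinM.
rewrite muleAC lee_pdivrMr//; apply: le_trans H _.
by rewrite (fineK Bfin).
Qed.

(** A supremum over no radii would be [-oo], so an admissible ball has to be exhibited: [B(x, 2)]
    contains the unit ball. *)
Lemma maximal_ge0 (x : Rn R n) : enorm x < 1 -> (0 <= maximal (nu R n) g x)%E.
Proof.
move=> x1; apply: le_ereal_sup_tmp.
have B2 : eball originRn (1 : R) `<=` eball x 2.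
  move=> y; rewrite eball_originE /eball/= => y1.
  rewrite -(ltr_pXn2r (n := 2)) ?nnegrE ?edist_ge0// edist_sqr.
  have x2 : enorm x ^+ 2 < 1 by rewrite expr_lt1// edist_ge0.
  have y2 : enorm y ^+ 2 < 1 by rewrite expr_lt1// edist_ge0.
  (* [|x - y|^2 <= 2 (|x|^2 + |y|^2) < 4]; the gap in the first inequality is [|x + y|^2]. *)
  apply: (@le_lt_trans _ _ (2 * (enorm x ^+ 2 + enorm y ^+ 2))); last by lra.
  rewrite !enorm_sqr -big_split mulr_sumr; apply: ler_sum => i _ /=.
  rewrite -subr_ge0 [leRHS](_ : _ = ((tnth x i : R) + tnth y i) ^+ 2) ?sqr_ge0//.
  by ring.
have nuB2 : (0 < nu R n (eball x 2))%E.
  apply: lt_le_trans (lebesgue_Rn_unit_ball_gt0 R n) _.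
  by apply: lebesgue_Rn_le => y y1; split=> //; exact: B2.
eexists; first by exists 2.
rewrite mule_ge0 ?integral_ge0// inve_ge0 ltW//.
Qed.

End radial_decreasing_maximal.

(** * From the pointwise bound to the weak-type inequality *)

Theorem theorem2p3 (R : realType) (n : nat) (n_gt0 : (0 < n)%N)
    (g : Rn R n -> \bar R) (g_rd : radial_decreasing g)
    (p : R) (p_ge2 : 2 <= p) :
  (weak_lorentz_norm (nu R n) p (maximal (nu R n) g) <=
   (p / (p - 1) * 2 `^ (2 / p))%:E * lorentz_norm (nu R n) p 1 g)%E.
Proof.
have p0 : 0 < p by exact: lt_le_trans p_ge2.
set N := lorentz_norm _ _ _ _.
have N0 : (0 <= N)%E by exact: poweR_ge0.
have K1 : 1 <= p / (p - 1) * 2 `^ (2 / p).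
  have p1 : 0 < p - 1 by lra.
  apply: (@le_trans _ _ (p / (p - 1) * 1)).
    by rewrite mulr1 ler_pdivlMr// mul1r; lra.
  rewrite ler_pM2l ?divr_gt0// -[leLHS](powRr0 2) ler_powR ?ler1n//.
  by rewrite divr_ge0 ?ltW.
(* The constant is at least 1, so it suffices to bound the weak quasinorm by [N]. *)
apply: (@le_trans _ _ N); last first.
  by rewrite -[leLHS]mul1e; apply: lee_wpmul2r => //; rewrite lee_fin.
apply: ge_ereal_sup => _ [s + <-]; rewrite /= in_itv/= andbT => s0.
have sp0 : 0 < s `^ p^-1 by exact: powR_gt0.
have [Noo|Nfin] : N = +oo%E \/ N \is a fin_num.
  by case: N N0 => [r| |//] _; [right|left].
  by rewrite Noo leey.
rewrite muleC -lee_pdivlMr//.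
(* The rearrangement at [s] is at most any admissible level. The level [N s^(-1/p)] is admissible
   once the superlevel set of the maximal function there has measure at most [s]. *)
apply: ge_ereal_inf; exists (fine N / s `^ p^-1)%:E; last by rewrite EFinM fineK.
have l0 : 0 <= fine N / s `^ p^-1 by apply: divr_ge0; [exact: fine_ge0|exact: ltW].
exists (fine N / s `^ p^-1) => //; split=> //.
have V0 := unit_ball_volume_gt0 R n.
have [rho rho_ge0 rhoE] := ball_radius_of_volume R n s n_gt0 (ltW s0).
have rho0 : 0 < rho.
  rewrite lt_neqAle rho_ge0 andbT eq_sym; apply: contraTneq s0 => rho0.
  by rewrite -rhoE rho0 expr0n gtn_eqF// mul0r ltxx.
apply: (@le_trans _ _ (lebesgue_Rn n (eball originRn rho))); last first.
  by rewrite lebesgue_Rn_eball// rhoE.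
(* The superlevel set lies in the centred ball of volume [s]: if [|x| >= rho > 0], the pointwise
   bound gives at most [N (|x|^n V)^(-1/p) <= N s^(-1/p)], with [V] the volume of the unit ball. *)
apply: lebesgue_Rn_le => x [/= lM]; rewrite !eball_originE /= => x1.
rewrite ltNge; apply/negP => rhox; move: lM; apply/negP; rewrite -leNgt.
have x0 : 0 < enorm x by exact: lt_le_trans rhox.
rewrite gee0_abs ?maximal_ge0//.
apply: le_trans (maximal_le_lorentz_norm _ _ n_gt0 _ g_rd _ _ p_ge2 x0 x1) _.
rewrite EFinM fineK//; apply: lee_wpmul2l => //.
rewrite lee_fin lef_pV2 ?posrE ?powR_gt0 ?mulr_gt0 ?exprn_gt0//.
rewrite ge0_ler_powR ?nnegrE ?invr_ge0 ?mulr_ge0 ?exprn_ge0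
  ?(ltW s0) ?(ltW p0) ?(ltW x0) ?(ltW V0)//.
by rewrite -rhoE ler_pM2r// ler_pXn2r// nnegrE ltW.
Qed.
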